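(* Let $\mathbb{K}$ be a field, $V$ an $n$-dimensional $\mathbb{K}$-vector space, $V_\bullet=(V_1\subset V_2\subset\dots\subset V_n=V)$ a complete flag in $V$ (with $\dim V_i=i$), let $k,l<n$ be positive integers, and let $U,W\subset V$ be linear subspaces with $\dim U=k$, $\dim W=l$. (i) There exist ordered bases $(u_1,\dots,u_k)$ of $U$, $(w_1,\dots,w_l)$ of $W$ and $(v_1,\dots,v_n)$ of $V$ such that: - $V_i=\langle v_1,\dots,v_i\rangle$ for each $i\in\{1,\dots,n\}$; - $u_i=v_{\alpha_i}$ for $i\in\{1,\dots,k\}$, where $\{\alpha_1,\dots,\alpha_k\}\subset\{1,\dots,n\}$; - each $w_j$ is either a basis vector of $V$ or a sum of two basis vectors: for some $0\le r\le l$, the vectors $w_1,\dots,w_l$ are, in some order, the vectors $v_{\beta_1},\dots,v_{\beta_{l-r}}$ and $v_{\gamma_1}+v_{\delta_1},\dots,v_{\gamma_r}+v_{\delta_r}$, where $\gamma_i>\delta_i$ and $v_{\gamma_i}\in U$ for all $i$ (that is, $\{\gamma_1,\dots,\gamma_r\}\subset\{\alpha_1,\dots,\alpha_k\}$); - all the numbers $\beta_i$, $\gamma_i$, $\delta_i$ are distinct; moreover, every $\delta_i$ is distinct from every $\alpha_j$. (ii) For bases as in (i), define the permutation $\sigma\in S_n$ as the product of all the transpositions $(\gamma_i,\delta_i)$, $1\le i\le r$ (these have disjoint supports, so the product does not depend on their order). Then, for a given pair $(U,W)$, the subsets $\bar\alpha=\{\alpha_1,\dots,\alpha_k\}$, $\bar\beta=\{\beta_1,\dots,\beta_{l-r}\}$,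 $\bar\gamma=\{\gamma_1,\dots,\gamma_r\}$ of $\{1,\dots,n\}$ and the permutation $\sigma$ are independent of the choice of the bases of $U$, $W$ and $V$ satisfying the conditions in (i).
   Context: Angle brackets $\langle\cdot\rangle$ denote the linear span of vectors. $S_n$ is the symmetric group on $\{1,\dots,n\}$. *)

(* Defs.v *)
From HB Require Import structures.
From mathcomp Require Import all_boot all_order all_fingroup all_algebra.

Set Implicit Arguments.
Unset Strict Implicit.
Unset Printing Implicit Defensive.

Import GRing.Theory.
Local Open Scope ring_scope.

(* All indices are 0-based: [F i] has dimension i.+1, so it is V_{i+1}.       *)
(* When n is the dimension of vT, the last space F (n - 1) is forced to be    *)
(* the whole space, and the inclusions are forced to be strict.               *)
Definition complete_flag (K : fieldType) (vT : vectType K) (n : nat)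
    (F : 'I_n -> {vspace vT}) : Prop :=
  (forall i : 'I_n, \dim (F i) = i.+1) /\
  (forall i j : 'I_n, (i < j)%N -> (F i <= F j)%VS).

Record adapted_bases (K : fieldType) (vT : vectType K) (n k l : nat)
    (F : 'I_n -> {vspace vT}) (U W : {vspace vT})
    (u : k.-tuple vT) (w : l.-tuple vT) (v : n.-tuple vT) (r : nat)
    (alpha : 'I_k -> 'I_n) (beta : 'I_(l - r) -> 'I_n)
    (gamma delta : 'I_r -> 'I_n) : Prop := AdaptedBases {
  adapted_basisU : basis_of U u;
  adapted_basisW : basis_of W w;
  adapted_basisV : basis_of fullv v;
  adapted_flag : forall i : 'I_n, F i = <<take i.+1 v>>%VS;
  adapted_alpha : forall i : 'I_k, tnth u i = tnth v (alpha i);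
  adapted_r : (r <= l)%N;
  adapted_w : perm_eq w
    ([seq tnth v (beta i) | i : 'I_(l - r)] ++
     [seq tnth v (gamma i) + tnth v (delta i) | i : 'I_r]);
  adapted_gt : forall i : 'I_r, (delta i < gamma i)%N;
  adapted_gammaU : forall i : 'I_r, tnth v (gamma i) \in U;
  adapted_uniq : uniq (codom beta ++ codom gamma ++ codom delta);
  adapted_delta_alpha :
    forall (i : 'I_r) (j : 'I_k), delta i != alpha j
}.

Definition sigma_perm (n r : nat) (gamma delta : 'I_r -> 'I_n) : {perm 'I_n} :=
  (\prod_(i < r) tperm (gamma i) (delta i))%g.

(* Main.v *)
Require Import Defs.
From HB Require Import structures.
From mathcomp Require Import all_boot all_order all_fingroup all_algebra.

Set Implicit Arguments.
Unset Strict Implicit.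
Unset Printing Implicit Defensive.

Import GRing.Theory.
Local Open Scope ring_scope.

(** Existence goes by induction along the flag, building the basis one vector
    at a time.  Suppose that v_0, ..., v_(m-1) solve the problem for the traces
    of U and W on the m-dimensional flag space G m.  If only one of U and W is
    larger in G m.+1, take as v_m a new vector of that subspace, which enters its
    basis; if neither is, take any vector of G m.+1 outside G m.  If both grow,
    by new vectors u and w, scale u so that w - u lies in G m.  When w - u is
    in the sum of the two traces, u and w can be corrected to a common vector,
    which is v_m.  Otherwise [nf_replace] changes one old basis vector v_d,
    used neither by U nor by W, so that w - u is v_d modulo the two traces;
    then v_m is taken in U and v_m + v_d in W, which creates the pair (m, d).

    Uniqueness: the index sets can be read off from the indices at which
    the traces of subspaces on the flag jump, which involve no basis.
    Write J(X) for the set of leading indices of nonzero vectors x of X, that is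
    of the least i with x in F i.
    In an adapted basis, a vector of U has zero coordinates outside alpha and
    a vector of W has equal coordinates at gamma_t and delta_t.  Hence
    J(U) = alpha, J(W) is the union of beta and gamma, and J(U :&: W) is
    the intersection of alpha and beta ([jumpU], [jumpW], [jumpUW]), so that
    J determines alpha, beta and gamma.  Finally delta_t is the least j such that
    gamma_t lies in J(W :&: (U + F j)) ([jump_gamma]); this recovers the
    pairing, hence sigma. *)

(** * Hyperplanes and lines *)

Section Lines.

Variables (K : fieldType) (vT : vectType K).
Implicit Types (A B X : {vspace vT}) (x y : vT).

Lemma dimv_add_line A y : y \notin A -> \dim (A + <[y]>) = (\dim A).+1.
Proof.
move=> yA; have y0 : y != 0 by apply: contraNneq yA => ->; exact: mem0v.
rewrite dimv_disjoint_sum ?dim_vline ?y0 ?addn1 //.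
apply/eqP; rewrite -subv0; apply/subvP => _ /memv_capP[/[swap] /vlineP[c ->]].
rewrite memv0 scaler_eq0 (negPf y0) orbF; apply: contraLR => c0.
by rewrite rpredZeq (negPf c0).
Qed.

Lemma hyperplane_add_line A B y :
  (A <= B)%VS -> \dim B = (\dim A).+1 -> y \in B -> y \notin A ->
  B = (A + <[y]>)%VS.
Proof.
move=> AB dB yB yA; apply/esym/eqP.
by rewrite eqEdim subv_add AB -memvE yB dimv_add_line // dB leqnn.
Qed.

Lemma cap_hyperplane_add_line A B X y :
    (A <= B)%VS -> \dim B = (\dim A).+1 -> (X <= B)%VS ->
    y \in X -> y \notin A ->
  X = (X :&: A + <[y]>)%VS.
Proof.
move=> AB dB XB yX yA; rewrite vspace_modr -?memvE //.
by rewrite -(hyperplane_add_line AB dB) ?(subvP XB) //; apply/esym/capv_idPl.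
Qed.

End Lines.

(** * Existence: normal forms along a flag *)

Section NormalForm.

Variables (K : fieldType) (vT : vectType K).
Implicit Types (X U W : {vspace vT}) (x y : vT) (v : nat -> vT).
Implicit Types (a b : seq nat) (g : seq (nat * nat)).

Variable G : nat -> {vspace vT}.

Definition supp b g := b ++ unzip1 g ++ unzip2 g.

(** The statement proved by induction on m.  Indices are plain numbers, so that
    nothing has to be recast when m grows; a pair (c, d) of g stands for
    the vector v_c + v_d of W.  The basis of the flag is encoded by
    v_i being in G i.+1 but not in G i, a condition local to each index, which
    survives the replacement of a single vector.  Freeness of the families
    spanning U and W is encoded by counting dimensions. *)
Record normal_form m U W v a b g : Prop := NormalForm {
  nf_flag : forall i, (i < m)%N -> (v i \in G i.+1) && (v i \notin G i);
  nf_U : U = <<map v a>>%VS;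
  nf_dimU : \dim U = size a;
  nf_W : W = <<map v b ++ [seq (v p.1 + v p.2)%R | p <- g]>>%VS;
  nf_dimW : \dim W = (size b + size g)%N;
  nf_lt : all (fun i => (i < m)%N) (a ++ supp b g);
  nf_uniq : uniq (supp b g);
  nf_pair : forall p, p \in g -> [&& (p.2 < p.1)%N, p.1 \in a & p.2 \notin a]
}.

Definition update v d y := fun i => if i == d then y else v i.

Lemma update_same v d y : update v d y d = y.
Proof. by rewrite /update eqxx. Qed.

Lemma update_neq v d y i : i != d -> update v d y i = v i.
Proof. by rewrite /update => /negPf->. Qed.

(** U and W see only the basis vectors indexed by a and [supp b g]; the other
    ones may be changed freely as long as they stay adapted to the flag. *)
Lemma nf_eq_in m m' U W v v' a b g : (m <= m')%N ->
    normal_form m U W v a b g ->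
    (forall i, (i < m')%N -> (v' i \in G i.+1) && (v' i \notin G i)) ->
    {in a ++ supp b g, v' =1 v} ->
  normal_form m' U W v' a b g.
Proof.
move=> le_mm' nf Hv' eqv; split=> //; try by case: nf.
- rewrite (nf_U nf); congr <<_>>%VS; apply/eq_in_map => i ia.
  by rewrite eqv // mem_cat ia.
- rewrite (nf_W nf); congr << _ ++ _ >>%VS; apply/eq_in_map.
    by move=> i ib; rewrite eqv // !mem_cat ib orbT.
  move=> p pg; rewrite !eqv ?mem_cat //.
    by rewrite [p.2 \in unzip2 g]map_f ?orbT.
  by rewrite [p.1 \in unzip1 g]map_f ?orbT.
- by apply: sub_all (nf_lt nf) => i /leq_trans; apply.
Qed.

(** For the second member of a pair, v_d = (v_c + v_d) - v_c, with v_c in U. *)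
Lemma nf_supp_mem m U W v a b g i : normal_form m U W v a b g ->
  i \in a ++ supp b g -> v i \in (U + W)%VS.
Proof.
move=> nf; have Ha j : j \in a -> v j \in U.
  by move=> ja; rewrite (nf_U nf) memv_span // map_f.
have HaW j : j \in a -> v j \in (U + W)%VS.
  by move=> /Ha; apply/subvP/addvSl.
have Hg p : p \in g -> v p.1 + v p.2 \in (U + W)%VS.
  move=> pg; apply: (subvP (addvSr U W)); rewrite (nf_W nf) memv_span //.
  by rewrite mem_cat (map_f (fun p => v p.1 + v p.2)) ?orbT.
rewrite !mem_cat => /or4P[/HaW//|ib||].
- apply: (subvP (addvSr U W)); rewrite (nf_W nf) memv_span //.
  by rewrite mem_cat map_f.
- by case/mapP=> p /(nf_pair nf)/and3P[_ pa _] ->; apply: HaW.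
- case/mapP=> p pg ->; have /and3P[_ pa _] := nf_pair nf pg.
  by rewrite -[v p.2](addKr (v p.1)) addrC rpredB ?Hg ?HaW.
Qed.

(** Choose the least d such that x is in G d.+1 + (U + W), and
    let the new v_d be the component of x in G d.+1.  By minimality
    that component is not in G d, and the old v_d is not in U + W, so that d
    indexes no vector used by U or W. *)
Lemma nf_replace m U W v a b g x :
    (forall i, (i <= m)%N -> \dim (G i) = i) ->
    (forall i, (i < m)%N -> (G i <= G i.+1)%VS) ->
    normal_form m U W v a b g -> x \in G m -> x \notin (U + W)%VS ->
  exists v' d, [/\ normal_form m U W v' a b g, (d < m)%N,
    d \notin a ++ supp b g & x - v' d \in (U + W)%VS].
Proof.
move=> dG sG nf xG xUW.
have exP : exists i, x \in (G i + (U + W))%VS.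
  by exists m; apply: (subvP (addvSl _ _)).
have [[|d] xd dmin] := ex_minnP exP.
  have /eqP : \dim (G 0) = 0%N by rewrite dG.
  by rewrite dimv_eq0 => /eqP G0; rewrite G0 add0v (negPf xUW) in xd.
have lt_dm : (d < m)%N by apply: dmin; apply: (subvP (addvSl _ _)).
have xd' : x \notin (G d + (U + W))%VS.
  by apply/negP => /dmin; rewrite ltnn.
have [z zG [s sUW xE]] := memv_addP xd.
have zd : z \notin G d.
  by apply: contraNN xd' => zd; rewrite xE memv_add.
have d_new : d \notin a ++ supp b g.
  apply: contraNN xd' => /(nf_supp_mem nf) vd.
  have /andP[vG vG'] := nf_flag nf lt_dm.
  have GE := hyperplane_add_line (sG _ lt_dm) (etrans (dG d.+1 lt_dm)
    (congr1 succn (esym (dG _ (ltnW lt_dm))))) vG vG'.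
  apply: (subvP _ _ xd); rewrite GE subv_add addvSr andbT.
  by apply: addvS => //; rewrite -memvE.
exists (update v d z), d; split=> //; last by rewrite update_same xE addrC addKr.
apply: (nf_eq_in (leqnn m) nf) => i.
  have [->|neq_id] := eqVneq i d; first by rewrite update_same zG.
  by rewrite update_neq //; exact: (nf_flag nf).
by move=> iS; apply: update_neq; apply: contraNneq d_new => <-.
Qed.

Lemma nf_new m U W v a b g :
  normal_form m U W v a b g -> m \notin a ++ supp b g.
Proof. by move=> nf; apply/negP => /(allP (nf_lt nf)); rewrite ltnn. Qed.

Lemma nf_extend m U W v a b g y :
    normal_form m U W v a b g -> y \in G m.+1 -> y \notin G m ->
  normal_form m.+1 U W (update v m y) a b g.
Proof.
move=> nf yG yG'; apply: (nf_eq_in (leqnSn m) nf) => i.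
  rewrite ltnS leq_eqVlt => /predU1P[->|ltim].
    by rewrite update_same yG.
  by rewrite update_neq ?ltn_eqF //; exact: (nf_flag nf).
move=> iS; apply: update_neq.
by apply: contraNneq (nf_new nf) => <-.
Qed.

Lemma nf_addU m U W v a b g i :
    normal_form m U W v a b g -> (i < m)%N -> i \notin supp b g ->
    v i \notin U ->
  normal_form m (U + <[v i]>) W v (i :: a) b g.
Proof.
move=> nf ltim iS iU; split; try by case: nf.
- by rewrite (nf_U nf) /= span_cons addvC.
- by rewrite dimv_add_line // (nf_dimU nf).
- by rewrite /= ltim (nf_lt nf).
move=> p pg; have /and3P[-> p1a p2a] := nf_pair nf pg.
rewrite !inE p1a orbT negb_or p2a andbT /=.
by apply: contraNneq iS => <-; rewrite !mem_cat [p.2 \in unzip2 g]map_f ?orbT.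
Qed.

Lemma nf_addW m U W v a b g i :
    normal_form m U W v a b g -> (i < m)%N -> i \notin supp b g ->
    v i \notin W ->
  normal_form m U (W + <[v i]>) v a (i :: b) g.
Proof.
move=> nf ltim iS iW; split; try by case: nf.
- by rewrite (nf_W nf) /= span_cons addvC.
- by rewrite dimv_add_line // (nf_dimW nf).
- by have := nf_lt nf; rewrite !all_cat /= ltim.
- by rewrite /= iS (nf_uniq nf).
Qed.

Lemma nf_addW_pair m U W v a b g c d :
    normal_form m U W v a b g -> (d < c < m)%N ->
    c \in a -> c \notin supp b g -> d \notin a ++ supp b g ->
    v c + v d \notin W ->
  normal_form m U (W + <[(v c + v d)%R]>) v a b ((c, d) :: g).
Proof.
move=> nf /andP[ltdc ltcm] ca cS; rewrite mem_cat => /norP[da dS] cdW.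
have permS : perm_eq (supp b ((c, d) :: g)) (c :: d :: supp b g).
  apply/seq.permP => P; rewrite /supp /= !count_cat /= !count_cat.
  rewrite (addnCA (count P b)) (addnCA (count P (unzip1 g))).
  by rewrite (addnCA (count P b)).
split; try by case: nf.
- by rewrite (nf_W nf) !span_cat /= span_cons -addvA [(<[_]> + _)%VS]addvC.
- by rewrite dimv_add_line // (nf_dimW nf) addnS.
- have := nf_lt nf; rewrite all_cat => /andP[lta ltS].
  by rewrite all_cat lta (perm_all _ permS) /= ltcm (ltn_trans ltdc ltcm).
- rewrite (perm_uniq permS) /= inE negb_or cS dS (nf_uniq nf) !andbT.
  by rewrite gtn_eqF.
- by move=> p; rewrite inE => /predU1P[->|/(nf_pair nf)//] /=; rewrite ltdc ca.
Qed.

Lemma nf_exists m U W :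
    (forall i, (i <= m)%N -> \dim (G i) = i) ->
    (forall i, (i < m)%N -> (G i <= G i.+1)%VS) ->
    (U <= G m)%VS -> (W <= G m)%VS ->
  exists v a b g, normal_form m U W v a b g.
Proof.
elim: m U W => [|m IH] U W dG sG UG WG.
  have /eqP : \dim (G 0) = 0%N by rewrite dG.
  rewrite dimv_eq0 => /eqP G0; move: UG WG; rewrite G0 !subv0 => /eqP-> /eqP->.
  by exists (fun=> 0), [::], [::], [::]; split; rewrite ?dimv0 //= ?span_nil.
have {}dG' i : (i <= m)%N -> \dim (G i) = i by move=> lem; apply/dG/leqW.
have {}sG' i : (i < m)%N -> (G i <= G i.+1)%VS by move=> ltm; apply/sG/leqW.
have GG := sG m (leqnn _).
have dGG : \dim (G m.+1) = (\dim (G m)).+1 by rewrite !dG.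
have [v [a [b [g nf]]]] :=
  IH (U :&: G m)%VS (W :&: G m)%VS dG' sG' (capvSr _ _) (capvSr _ _).
have new := nf_new nf.
have newS : m \notin supp b g by move: new; rewrite mem_cat => /norP[].
have capE X y : (X <= G m.+1)%VS -> y \in X -> y \notin G m ->
    (X :&: G m + <[y]>)%VS = X.
  by move=> XG yX yG; rewrite -(cap_hyperplane_add_line GG dGG).
have notcap X y : y \notin G m -> y \notin (X :&: G m)%VS.
  by apply: contraNN => /memv_capP[].
(* In the first three cases at most one of U and W grows from G m to G m.+1. *)
have [UGm|/subvPn[u uU uG]] := boolP (U <= G m)%VS;
  have [WGm|/subvPn[w wW wG]] := boolP (W <= G m)%VS.
- have GG' : ~~ (G m.+1 <= G m)%VS.
    by apply/negP => /dimvS; rewrite dGG ltnn.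
  have [y yG yG'] := subvPn GG'.
  exists (update v m y), a, b, g; move: (nf_extend nf yG yG').
  by rewrite (capv_idPl UGm) (capv_idPl WGm).
- exists (update v m w), a, (m :: b), g.
  have := nf_extend nf (subvP WG _ wW) wG.
  move/nf_addW => /(_ m (leqnn _) newS); rewrite update_same => /(_ (notcap _ _ wG)).
  by rewrite (capv_idPl UGm) capE.
- exists (update v m u), (m :: a), b, g.
  have := nf_extend nf (subvP UG _ uU) uG.
  move/nf_addU => /(_ m (leqnn _) newS); rewrite update_same => /(_ (notcap _ _ uG)).
  by rewrite (capv_idPl WGm) capE.
(* Both grow; the scalar makes u and w agree modulo the hyperplane G m. *)
have [c cuG] : exists2 c, c != 0 & w - c *: u \in G m.
  have := subvP WG _ wW; rewrite (hyperplane_add_line GG dGG (subvP UG _ uU) uG).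
  case/memv_addP=> x xG [_ /vlineP[c ->] wE]; exists c; last by rewrite wE addrK.
  by apply: contraNneq wG => c0; rewrite wE c0 scale0r addr0.
move: {u uU uG} (c *: u) (memvZ c uU) => u uU wuG.
have uG : u \notin G m.
  by apply: contraNN wG => uG; rewrite -(subrK u w) rpredD.
(* If the difference lies in the sum of the traces, correcting u and w by its
   two components gives a common new vector y, so that m enters both a and b. *)
have [wu|wu] := boolP (w - u \in (U :&: G m + W :&: G m)%VS).
  have [u' /memv_capP[u'U u'G] [w' /memv_capP[w'W w'G] wuE]] := memv_addP wu.
  pose y := u + u'.
  have yE : y = w - w' by apply/eqP; rewrite eq_sym subr_eq -addrA -wuE subrKC.
  have yU : y \in U by rewrite rpredD.
  have yW : y \in W by rewrite yE rpredB.
  have yG : y \notin G m by apply: contraNN uG => yG; rewrite -(addrK u' u) rpredB.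
  exists (update v m y), (m :: a), (m :: b), g.
  have := nf_extend nf (subvP UG _ yU) yG.
  move/nf_addU => /(_ m (leqnn _) newS); rewrite update_same => /(_ (notcap _ _ yG)).
  move/nf_addW => /(_ m (leqnn _) newS); rewrite update_same => /(_ (notcap _ _ yG)).
  by rewrite !capE.
(* Otherwise w - u becomes a basis vector v' d up to components u' and w' in
   the traces, and y = u + u' and y + v' d = w - w' give the pair (m, d). *)
have [v' [d [nf' ltdm dS wuv]]] := nf_replace dG' sG' nf wuG wu.
have [u' /memv_capP[u'U u'G] [w' /memv_capP[w'W w'G] wuE]] := memv_addP wuv.
pose y := u + u'.
have yE : y + v' d = w - w'.
  apply: (addIr w'); rewrite subrK -[w in RHS](subrK u).
  by rewrite -[w - u](subrK (v' d)) wuE [RHS]addrC !addrA addrAC.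
have yU : y \in U by rewrite rpredD.
have yG : y \notin G m by apply: contraNN uG => yG; rewrite -(addrK u' u) rpredB.
have ydW : y + v' d \in W by rewrite yE rpredB.
have ydG : y + v' d \notin G m.
  by rewrite yE; apply: contraNN wG => wG; rewrite -(subrK w' w) rpredD.
exists (update v' m y), (m :: a), b, ((m, d) :: g).
have := nf_extend nf' (subvP UG _ yU) yG.
move/nf_addU => /(_ m (leqnn _) newS); rewrite update_same => /(_ (notcap _ _ yG)).
move/nf_addW_pair => /(_ m d); rewrite ltdm leqnn mem_head => /(_ isT isT newS).
rewrite !inE negb_or (ltn_eqF ltdm) => /(_ dS).
rewrite update_same update_neq ?ltn_eqF // => /(_ (notcap _ _ ydG)).
by rewrite !capE.
Qed.

End NormalForm.

(** * Existence: from normal forms to adapted bases *)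

Lemma map_nth_ord (T T' : Type) (x0 : T) (f : T -> T') (s : seq T) m :
  size s = m -> [seq f (nth x0 s i) | i : 'I_m] = map f s.
Proof.
move=> <-; rewrite /image_mem -[in RHS](mkseq_nth x0 s) /mkseq -map_comp.
by rewrite -[iota 0 _]val_enum_ord -map_comp enumT.
Qed.

Lemma flag_span (K : fieldType) (vT : vectType K) (G : nat -> {vspace vT})
    (v : nat -> vT) n :
    (forall i, (i <= n)%N -> \dim (G i) = i) ->
    (forall i, (i < n)%N -> (G i <= G i.+1)%VS) ->
    (forall i, (i < n)%N -> (v i \in G i.+1) && (v i \notin G i)) ->
  forall i, (i <= n)%N -> G i = <<mkseq v i>>%VS.
Proof.
move=> dG sG vG; elim=> [_|i IH ltin].
  by apply/eqP; rewrite span_nil -dimv_eq0 dG.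
have /andP[viG viG'] := vG i ltin.
rewrite /mkseq -[in RHS]addn1 iotaD map_cat span_cat -[map _ _]/(mkseq v i).
rewrite -(IH (ltnW ltin)) /= span_seq1 add0n.
by apply: hyperplane_add_line; rewrite ?sG ?dG // ltnW.
Qed.

Lemma adapted_bases_exist (K : fieldType) (vT : vectType K) (n k l : nat)
    (F : 'I_n -> {vspace vT}) (U W : {vspace vT}) :
    \dim {:vT} = n -> complete_flag F -> (0 < n)%N ->
    \dim U = k -> \dim W = l ->
  exists (u : k.-tuple vT) (w : l.-tuple vT) (v : n.-tuple vT) (r : nat)
         (alpha : 'I_k -> 'I_n) (beta : 'I_(l - r) -> 'I_n)
         (gamma delta : 'I_r -> 'I_n),
    adapted_bases F U W u w v alpha beta gamma delta.
Proof.
move=> dimV [dimF subF] n_gt0 dimU dimW.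
(* The flag is extended by the zero space, so that G i has dimension i; [i0] is
   only the default value of the conversions from numbers to ordinals. *)
pose i0 := Ordinal n_gt0.
pose G i := if i is j.+1 then F (insubd i0 j) else 0%VS.
have dG i : (i <= n)%N -> \dim (G i) = i.
  by case: i => [|i] ltin; rewrite /= ?dimv0 // dimF val_insubd ltin.
have sG i : (i < n)%N -> (G i <= G i.+1)%VS.
  case: i => [|i] ltin; first exact: sub0v.
  by apply: subF; rewrite !val_insubd ltin (ltnW ltin).
have Gn : G n = {:vT}%VS by apply/eqP; rewrite eqEdim subvf dG // dimV /=.
have [v [a [b [g nf]]]] : exists v a b g, normal_form G n U W v a b g.
  by apply: nf_exists; rewrite ?Gn ?subvf.
have vG := flag_span dG sG (nf_flag nf).
have sza : size (map v a) == k by rewrite size_map -(nf_dimU nf) dimU.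
have szw : size (map v b ++ [seq v p.1 + v p.2 | p <- g]) == l.
  by rewrite size_cat !size_map -(nf_dimW nf) dimW.
have lE : l = (size b + size g)%N by rewrite -dimW (nf_dimW nf).
have szb : size b = (l - size g)%N by rewrite lE addnK.
have ltS i : i \in supp b g -> (i < n)%N.
  by move=> iS; apply: (allP (nf_lt nf)); rewrite mem_cat iS orbT.
have lta i : i \in a -> (i < n)%N.
  by move=> iS; apply: (allP (nf_lt nf)); rewrite mem_cat iS.
have ltg p : p \in g -> (p.1 < n)%N /\ (p.2 < n)%N.
  by move=> pg; split; apply: ltS; rewrite !mem_cat
    ?[p.1 \in unzip1 g]map_f ?[p.2 \in unzip2 g]map_f ?orbT.
have tvE i : (i < n)%N -> tnth [tuple of mkseq v n] (insubd i0 i) = v i.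
  by move=> ltin; rewrite (tnth_nth 0) nth_mkseq val_insubd ltin.
pose gp (i : 'I_(size g)) := nth (0, 0)%N g i.
have gpg i : gp i \in g by apply: mem_nth.
exists (Tuple sza), (Tuple szw), [tuple of mkseq v n], (size g).
exists (fun i => insubd i0 (nth 0%N a i)), (fun i => insubd i0 (nth 0%N b i)).
exists (fun i => insubd i0 (gp i).1), (fun i => insubd i0 (gp i).2).
have an (i : 'I_k) : nth 0%N a i \in a.
  by rewrite mem_nth // -(nf_dimU nf) dimU.
split.
- by rewrite basisEdim /= -(nf_U nf) subvv (nf_dimU nf) size_map /=.
- by rewrite basisEdim /= -(nf_W nf) subvv (eqP szw) dimW /=.
- by rewrite basisEdim /= -vG // Gn subvv dimV size_mkseq /=.
- move=> i; rewrite /= -map_take take_iota (minn_idPl (ltn_ord i)).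
  by rewrite -[map _ _]/(mkseq v i.+1) -vG // /G valKd.
- move=> i; rewrite tvE ?lta //.
  by rewrite (tnth_nth 0) (nth_map 0%N) // -(nf_dimU nf) dimU.
- by rewrite lE leq_addl.
- rewrite /= -(map_nth_ord 0%N v szb).
  rewrite -(map_nth_ord (0, 0)%N (fun p => v p.1 + v p.2) (erefl (size g))).
  have eq_perm (s t : seq vT) : s = t -> perm_eq s t by move->.
  apply: perm_cat; apply: eq_perm; apply: eq_map => i.
    by rewrite tvE // ltS // mem_cat mem_nth // szb.
  by have /ltg[ltn1 ltn2] := gpg i; rewrite !tvE.
- move=> i; rewrite !val_insubd; have /ltg[-> ->] := gpg i.
  by have /and3P[] := nf_pair nf (gpg i).
- move=> i; have /ltg[ltn1 _] := gpg i; rewrite tvE //.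
  have /and3P[_ ga _] := nf_pair nf (gpg i).
  by rewrite (nf_U nf) memv_span // map_f.
- rewrite /codom (map_nth_ord 0%N (insubd i0) szb).
  rewrite (map_nth_ord (0, 0)%N (fun p => insubd i0 p.1) (erefl (size g))).
  rewrite (map_nth_ord (0, 0)%N (fun p => insubd i0 p.2) (erefl (size g))).
  apply: (@map_uniq _ _ val).
  rewrite (_ : map _ _ = supp b g) ?(nf_uniq nf) //.
  rewrite /supp !map_cat -!map_comp; congr (_ ++ (_ ++ _)).
  + rewrite -[RHS]map_id; apply/eq_in_map => i ib /=.
    by rewrite val_insubd ltS // mem_cat ib.
  + by apply/eq_in_map => p /ltg[ltn1 _] /=; rewrite val_insubd ltn1.
  + by apply/eq_in_map => p /ltg[_ ltn2] /=; rewrite val_insubd ltn2.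
- move=> i j; have /ltg[_ ltn2] := gpg i.
  have /and3P[_ _] := nf_pair nf (gpg i); apply: contraNneq.
  by move/(congr1 val); rewrite !val_insubd ltn2 lta // => ->.
Qed.

(** * Uniqueness: leading indices and jumps *)

Lemma scalar_eq0_span (K : fieldType) (vT : vectType K) (X : seq vT)
    (f : {scalar vT}) (x : vT) :
  {in X, forall y, f y = 0} -> x \in <<X>>%VS -> f x = 0.
Proof.
move=> fX xX; have {xX} xX : x \in <<in_tuple X>>%VS by [].
rewrite (coord_span xX) linear_sum big1 // => i _.
by rewrite linearZ /= fX ?mulr0 // mem_nth.
Qed.

Section Jumps.

Variables (K : fieldType) (vT : vectType K) (n : nat).
Variable F : 'I_n -> {vspace vT}.

(** The leading index is the place at which x enters the flag. *)
Definition leading (x : vT) (i : 'I_n) : Prop :=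
  x != 0 /\ forall j, (x \in F j) = (i <= j)%N.

Definition jump (X : {vspace vT}) (i : 'I_n) : Prop :=
  exists2 x, x \in X & leading x i.

Variable v : n.-tuple vT.
Hypothesis basis_v : basis_of fullv v.
Hypothesis flag_v : forall i : 'I_n, F i = <<take i.+1 v>>%VS.

Lemma coord_tnth (i j : 'I_n) : coord v i (tnth v j) = (i == j)%:R.
Proof. by rewrite (tnth_nth 0) coord_free ?(basis_free basis_v) // eq_sym. Qed.

Lemma mem_flagP (x : vT) (j : 'I_n) :
  x \in F j <-> (forall i : 'I_n, (j < i)%N -> coord v i x = 0).
Proof.
rewrite flag_v; split=> [xF i ltji|x0].
  apply: scalar_eq0_span xF => y /(nthP 0)[m]; rewrite size_takel ?size_tuple //.
  move=> ltmj <-; rewrite nth_take //.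
  have ltmn : (m < n)%N by apply: leq_trans ltmj _.
  have -> : v`_m = tnth v (Ordinal ltmn) by rewrite (tnth_nth 0).
  rewrite /= coord_tnth -val_eqE gtn_eqF //.
  by apply: leq_trans ltmj _.
rewrite (coord_basis basis_v (memvf x)); apply: memv_suml => i _.
have [ltji|leij] := ltnP j i; first by rewrite x0 // scale0r mem0v.
apply/memvZ/memv_span; rewrite -(nth_take 0 (leij : (i < j.+1)%N)).
by rewrite mem_nth // size_takel // size_tuple.
Qed.

(** This links the flag, which is given, to coordinates in a basis adapted to it,
    which is chosen: the leading index is that of the last nonzero coordinate. *)
Lemma leadingP (x : vT) (i : 'I_n) :
  leading x i <->
  coord v i x != 0 /\ (forall j : 'I_n, (i < j)%N -> coord v j x = 0).
Proof.
split=> [[x0 xF]|[xi xj]]; last first.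
  split=> [|j]; first by apply: contraNneq xi => ->; rewrite linear0.
  apply/idP/idP => [/mem_flagP xF|leij].
    by rewrite leqNgt; apply: contraNN xi => /xF->.
  by apply/mem_flagP => m ltjm; apply: xj; apply: leq_ltn_trans ltjm.
have /mem_flagP xi : x \in F i by rewrite xF.
split=> //; apply/eqP => xi0.
have xle (m : 'I_n) : (i <= m)%N -> coord v m x = 0.
  by rewrite leq_eqVlt => /predU1P[/val_inj<-|/xi].
have [i0|i_gt0] := posnP i.
  case/eqP: x0; rewrite (coord_basis basis_v (memvf x)) big1 // => m _.
  by rewrite xle ?scale0r // i0.
have lti : (i.-1 < n)%N by apply: leq_ltn_trans (leq_pred i) _.
have : x \in F (Ordinal lti).
  by apply/mem_flagP => m; rewrite /= prednK //; apply: xle.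
by rewrite xF /= -ltnS prednK // ltnn.
Qed.

Lemma leading_tnth i : leading (tnth v i) i.
Proof.
apply/leadingP; rewrite coord_tnth eqxx oner_eq0; split=> // j ltij.
by rewrite coord_tnth -val_eqE gtn_eqF.
Qed.

Lemma leading_tnthD (i j : 'I_n) : (j < i)%N -> leading (tnth v i + tnth v j) i.
Proof.
move=> ltji; apply/leadingP; rewrite linearD /= !coord_tnth eqxx.
rewrite -(val_eqE i j) gtn_eqF // addr0 oner_eq0; split=> // m ltim.
rewrite linearD /= !coord_tnth -!val_eqE !gtn_eqF ?addr0 //.
exact: ltn_trans ltim.
Qed.

End Jumps.

(** * Uniqueness: reading off the index sets *)

Section Invariants.

Variables (K : fieldType) (vT : vectType K) (n k l r : nat).
Variables (F : 'I_n -> {vspace vT}) (U W : {vspace vT}).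
Variables (u : k.-tuple vT) (w : l.-tuple vT) (v : n.-tuple vT).
Variables (alpha : 'I_k -> 'I_n) (beta : 'I_(l - r) -> 'I_n).
Variables (gamma delta : 'I_r -> 'I_n).
Hypothesis ab : adapted_bases F U W u w v alpha beta gamma delta.

Let basis_v : basis_of fullv v.
Proof. exact: adapted_basisV ab. Qed.

Let flag_v (i : 'I_n) : F i = <<take i.+1 v>>%VS.
Proof. exact: adapted_flag ab i. Qed.

Lemma mem_alpha i : tnth v (alpha i) \in U.
Proof.
by rewrite -(adapted_alpha ab) (basis_mem (adapted_basisU ab)) ?mem_tnth.
Qed.

Lemma mem_beta i : tnth v (beta i) \in W.
Proof.
rewrite (basis_mem (adapted_basisW ab)) // (perm_mem (adapted_w ab)) mem_cat.
by rewrite (image_f (fun i => tnth v (beta i))).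
Qed.

Lemma mem_pair i : tnth v (gamma i) + tnth v (delta i) \in W.
Proof.
rewrite (basis_mem (adapted_basisW ab)) // (perm_mem (adapted_w ab)) mem_cat.
by rewrite (image_f (fun i => tnth v (gamma i) + tnth v (delta i))) ?orbT.
Qed.

Lemma coordU x i : x \in U -> coord v i x != 0 -> i \in codom alpha.
Proof.
rewrite -(span_basis (adapted_basisU ab)) => xU.
apply: contraR => ia; apply/eqP; apply: scalar_eq0_span xU => _ /tnthP[j ->].
rewrite (adapted_alpha ab) /= (coord_tnth basis_v).
by case: eqP ia => // ->; rewrite codom_f.
Qed.

Let generatorsW (f : {scalar vT}) x : x \in W ->
  (forall i, f (tnth v (beta i)) = 0) ->
  (forall i, f (tnth v (gamma i) + tnth v (delta i)) = 0) -> f x = 0.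
Proof.
rewrite -(span_basis (adapted_basisW ab)) => xW fb fg.
apply: scalar_eq0_span xW => y; rewrite (perm_mem (adapted_w ab)) mem_cat.
by case/orP=> /mapP[i _ ->].
Qed.

Lemma beta_neq_gamma i j : beta i != gamma j.
Proof.
have := adapted_uniq ab; rewrite !cat_uniq has_cat negb_or.
case/and3P=> _ /andP[/hasPn/(_ _ (codom_f gamma j)) H _] _.
by apply: contraNneq H => <-; rewrite /= codom_f.
Qed.

Lemma beta_neq_delta i j : beta i != delta j.
Proof.
have := adapted_uniq ab; rewrite !cat_uniq has_cat negb_or.
case/and3P=> _ /andP[_ /hasPn/(_ _ (codom_f delta j)) H] _.
by apply: contraNneq H => <-; rewrite /= codom_f.
Qed.

Lemma gamma_neq_delta i j : gamma i != delta j.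
Proof.
have := adapted_uniq ab; rewrite !cat_uniq has_cat negb_or.
case/and3P=> _ _ /and3P[_ /hasPn/(_ _ (codom_f delta j)) H _].
by apply: contraNneq H => <-; rewrite /= codom_f.
Qed.

Lemma gamma_inj : injective gamma.
Proof.
apply/injectiveP; have := adapted_uniq ab.
by rewrite /injectiveb /dinjectiveb !cat_uniq => /and3P[_ _ /and3P[]].
Qed.

Lemma delta_inj : injective delta.
Proof.
apply/injectiveP; have := adapted_uniq ab.
by rewrite /injectiveb /dinjectiveb !cat_uniq => /and3P[_ _ /and3P[]].
Qed.

Lemma gamma_alpha i : gamma i \in codom alpha.
Proof.
by apply: (coordU (adapted_gammaU ab i)); rewrite (coord_tnth basis_v) eqxx oner_eq0.
Qed.

Lemma delta_notin_alpha i : delta i \notin codom alpha.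
Proof. by apply/codomP => -[j /eqP]; apply/negP/(adapted_delta_alpha ab). Qed.

Lemma coordW x i : x \in W -> coord v i x != 0 ->
  [|| i \in codom beta, i \in codom gamma | i \in codom delta].
Proof.
move=> xW; apply: contraR; rewrite !negb_or => /and3P[ib ig id]; apply/eqP.
have neq m (h : 'I_m -> 'I_n) j : i \notin codom h -> (i == h j) = false.
  by move=> ih; apply: contraNF ih => /eqP->; rewrite codom_f.
apply: (generatorsW (f := coord v i) xW) => j.
  by rewrite /= (coord_tnth basis_v) neq.
by rewrite linearD /= !(coord_tnth basis_v) !neq // addr0.
Qed.

(** The linear form comparing the coordinates at gamma_i and delta_i vanishes
    on the basis of W, because all the indices are distinct. *)
Lemma coordW_pair x i : x \in W -> coord v (gamma i) x = coord v (delta i) x.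
Proof.
move=> xW; apply/eqP; rewrite -subr_eq0; apply/eqP.
apply: (generatorsW (f := coord v (gamma i) \- coord v (delta i)) xW) => j /=.
  rewrite !(coord_tnth basis_v) ![_ == beta j]eq_sym (negPf (beta_neq_gamma _ _)).
  by rewrite (negPf (beta_neq_delta _ _)) subrr.
rewrite !linearD /= !(coord_tnth basis_v) (inj_eq gamma_inj) (inj_eq delta_inj).
rewrite [_ == gamma j]eq_sym !(negPf (gamma_neq_delta _ _)).
by rewrite addr0 add0r subrr.
Qed.

Lemma jumpU i : jump F U i <-> i \in codom alpha.
Proof.
split=> [[x xU /(leadingP basis_v flag_v)[xi _]]|/codomP[j ->]].
  exact: coordU xi.
by exists (tnth v (alpha j)); [exact: mem_alpha | exact: leading_tnth].
Qed.

(** No delta_t occurs: a vector of W with a nonzero coordinate at delta_t has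
    one at the larger index gamma_t too. *)
Lemma jumpW i : jump F W i <-> i \in codom beta \/ i \in codom gamma.
Proof.
split=> [[x xW /(leadingP basis_v flag_v)[xi xgt]]|[]/codomP[j ->]].
- have /or3P[->|->|/codomP[j ij]] := coordW xW xi; [by left | by right |].
  case/eqP: xi; rewrite ij -coordW_pair //.
  by apply: xgt; rewrite ij; apply: adapted_gt ab _.
- by exists (tnth v (beta j)); [exact: mem_beta | exact: leading_tnth].
- exists (tnth v (gamma j) + tnth v (delta j)); first exact: mem_pair.
  exact: (leading_tnthD basis_v flag_v (adapted_gt ab _)).
Qed.

(** A vector of U has coordinate 0 at delta_t, hence also at gamma_t if it lies
    in W: the pairs contribute nothing to the intersection. *)
Lemma jumpUW i : jump F (U :&: W) i <-> i \in codom alpha /\ i \in codom beta.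
Proof.
split=> [[x /memv_capP[xU xW]]|[ia /codomP[j ij]]]; last first.
  exists (tnth v i); last exact: leading_tnth.
  case/codomP: (ia) => m im; rewrite memv_cap {1}im mem_alpha ij.
  exact: mem_beta.
case/(leadingP basis_v flag_v)=> xi _; have ia := coordU xU xi; split=> //.
have /or3P[//|/codomP[j ij]|/codomP[j ij]] := coordW xW xi.
  have: coord v (delta j) x != 0 by rewrite -coordW_pair // -ij.
  by move/(coordU xU); rewrite (negPf (delta_notin_alpha j)).
by move: ia; rewrite ij (negPf (delta_notin_alpha j)).
Qed.

(** If x = y + z with y in U and z in F j has leading index gamma_t, then x has
    a nonzero coordinate at delta_t; since y has none, z has one,
    so that delta_t <= j. *)
Lemma jump_gamma t j : jump F (W :&: (U + F j)) (gamma t) <-> (delta t <= j)%N.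
Proof.
split=> [[x /memv_capP[xW /memv_addP[y yU [z zF xyz]]]]|ledj].
  case/(leadingP basis_v flag_v)=> xg _.
  rewrite leqNgt; apply: contraNN xg => ltjd; rewrite coordW_pair // xyz.
  rewrite linearD /= (mem_flagP basis_v flag_v z j).1 // addr0.
  by apply: contraNT (delta_notin_alpha t); apply: coordU.
exists (tnth v (gamma t) + tnth v (delta t)).
  rewrite memv_cap mem_pair memv_add ?(adapted_gammaU ab) //.
  by have [_ ->] := leading_tnth basis_v flag_v (delta t).
exact: (leading_tnthD basis_v flag_v (adapted_gt ab _)).
Qed.

(** The part of beta inside alpha is J(U :&: W); the part outside is the part
    of J(W) outside J(U), since gamma lies in alpha. *)
Lemma betaP i : i \in codom beta <->
  jump F (U :&: W) i \/ jump F W i /\ ~ jump F U i.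
Proof.
split=> [ib|[/jumpUW[]//|[/jumpW[]// /codomP[j ->] []]]]; last first.
  exact/jumpU/gamma_alpha.
have [ia|ia] := boolP (i \in codom alpha); first by left; apply/jumpUW.
by right; split; [apply/jumpW; left | move=> /jumpU; apply/negP].
Qed.

Lemma gammaP i : i \in codom gamma <->
  [/\ jump F W i, jump F U i & ~ jump F (U :&: W) i].
Proof.
split=> [ig|[/jumpW[ib|//] /jumpU ia []]]; last exact/jumpUW.
split; first by apply/jumpW; right.
  by case/codomP: ig => j ->; apply/jumpU/gamma_alpha.
case/codomP: ig => j -> /jumpUW[_ /codomP[m /eqP]]; rewrite eq_sym.
exact/negP/beta_neq_gamma.
Qed.

End Invariants.

(** * Uniqueness: the permutation *)

Section Transpositions.

Variables (T : finType) (I : eqType) (g d : I -> T).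
Implicit Type s : seq I.

Lemma prod_tperm_out s x :
    (forall i, i \in s -> x != g i) -> (forall i, i \in s -> x != d i) ->
  (\prod_(i <- s) tperm (g i) (d i))%g x = x.
Proof.
elim: s => [|i s IH] xg xd; first by rewrite big_nil perm1.
rewrite big_cons permM tpermD ?[_ == x]eq_sym ?xg ?xd ?mem_head //.
by apply: IH => j js; rewrite ?xg ?xd // inE js orbT.
Qed.

Hypotheses (g_inj : injective g) (d_inj : injective d).
Hypothesis gd : forall i j, g i != d j.

Lemma prod_tperm_in s i : uniq s -> i \in s ->
  (\prod_(j <- s) tperm (g j) (d j))%g (g i) = d i /\
  (\prod_(j <- s) tperm (g j) (d j))%g (d i) = g i.
Proof.
elim: s => // j s IH /= /andP[js us]; rewrite inE big_cons !permM.
have [-> _|neq_ij /= /(IH us) IHi] := eqVneq i j.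
  rewrite tpermL tpermR !prod_tperm_out // => m ms.
  - by rewrite (inj_eq g_inj); apply: contraNneq js => ->.
  - by rewrite eq_sym.
  - by rewrite (inj_eq d_inj); apply: contraNneq js => ->.
by rewrite !tpermD // ?(inj_eq g_inj) ?(inj_eq d_inj) 1?[d _ == _]eq_sym // eq_sym.
Qed.

End Transpositions.

Section Sigma.

Variables (n r : nat) (gamma delta : 'I_r -> 'I_n).
Hypotheses (gamma_inj : injective gamma) (delta_inj : injective delta).
Hypothesis gamma_neq_delta : forall i j, gamma i != delta j.

Lemma sigma_gamma t : sigma_perm gamma delta (gamma t) = delta t.
Proof.
have [] := prod_tperm_in gamma_inj delta_inj gamma_neq_delta
  (index_enum_uniq _) (mem_index_enum t).
by [].
Qed.

Lemma sigma_delta t : sigma_perm gamma delta (delta t) = gamma t.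
Proof.
have [] := prod_tperm_in gamma_inj delta_inj gamma_neq_delta
  (index_enum_uniq _) (mem_index_enum t).
by [].
Qed.

Lemma sigma_out i : i \notin codom gamma -> i \notin codom delta ->
  sigma_perm gamma delta i = i.
Proof.
move=> ig id; apply: prod_tperm_out => t _.
  by apply: contraNneq ig => ->; apply: codom_f.
by apply: contraNneq id => ->; apply: codom_f.
Qed.

End Sigma.

(** The two products may list the same pairs in different orders, so they are
    compared value by value. *)
Lemma sigma_perm_eq n r r' (gamma delta : 'I_r -> 'I_n)
    (gamma' delta' : 'I_r' -> 'I_n) :
    injective gamma -> injective delta -> (forall i j, gamma i != delta j) ->
    injective gamma' -> injective delta' -> (forall i j, gamma' i != delta' j) ->
    codom gamma =i codom gamma' ->
    (forall s t, gamma s = gamma' t -> delta s = delta' t) ->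
  sigma_perm gamma delta = sigma_perm gamma' delta'.
Proof.
move=> gI dI gd gI' dI' gd' eqg eqd.
have eqd_codom : codom delta =i codom delta'.
  move=> i; apply/codomP/codomP => -[s ->].
    have /codomP[t st] : gamma s \in codom gamma' by rewrite -eqg codom_f.
    by exists t; apply: eqd.
  have /codomP[t st] : gamma' s \in codom gamma by rewrite eqg codom_f.
  by exists t; rewrite (eqd t s).
apply/permP => i.
have [/codomP[s si]|ig] := boolP (i \in codom gamma).
  have /codomP[t st] : gamma s \in codom gamma' by rewrite -eqg codom_f.
  by rewrite si sigma_gamma // st sigma_gamma //; apply: eqd.
have [/codomP[s si]|id] := boolP (i \in codom delta); last first.
  by rewrite !sigma_out // -?eqg -?eqd_codom.
have /codomP[t st] : gamma s \in codom gamma' by rewrite -eqg codom_f.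
by rewrite si sigma_delta // (eqd s t st) sigma_delta.
Qed.

Theorem proposition1 (K : fieldType) (vT : vectType K) (n k l : nat)
    (F : 'I_n -> {vspace vT}) (U W : {vspace vT})
    (dimV : \dim {:vT} = n) (flagF : complete_flag F)
    (k_gt0 : (0 < k)%N) (k_lt_n : (k < n)%N)
    (l_gt0 : (0 < l)%N) (l_lt_n : (l < n)%N)
    (dimU : \dim U = k) (dimW : \dim W = l) :
  (exists (u : k.-tuple vT) (w : l.-tuple vT) (v : n.-tuple vT) (r : nat)
          (alpha : 'I_k -> 'I_n) (beta : 'I_(l - r) -> 'I_n)
          (gamma delta : 'I_r -> 'I_n),
     adapted_bases F U W u w v alpha beta gamma delta)
  /\
  (forall (u u' : k.-tuple vT) (w w' : l.-tuple vT) (v v' : n.-tuple vT)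
          (r r' : nat) (alpha alpha' : 'I_k -> 'I_n)
          (beta : 'I_(l - r) -> 'I_n) (beta' : 'I_(l - r') -> 'I_n)
          (gamma delta : 'I_r -> 'I_n) (gamma' delta' : 'I_r' -> 'I_n),
     adapted_bases F U W u w v alpha beta gamma delta ->
     adapted_bases F U W u' w' v' alpha' beta' gamma' delta' ->
     [/\ [set alpha i | i : 'I_k] = [set alpha' i | i : 'I_k],
         [set beta i | i : 'I_(l - r)] = [set beta' i | i : 'I_(l - r')],
         [set gamma i | i : 'I_r] = [set gamma' i | i : 'I_r']
       & sigma_perm gamma delta = sigma_perm gamma' delta']).
Proof.
split; first exact: adapted_bases_exist (leq_ltn_trans _ k_lt_n) dimU dimW.
move=> u u' w w' v v' r r' alpha alpha' beta beta' gamma delta gamma' delta' A A'.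
have iffb (b c : bool) P : (b <-> P) -> (c <-> P) -> b = c.
  by move=> [bP Pb] [cP Pc]; apply/idP/idP => [/bP/Pc|/cP/Pb].
have eq_a : codom alpha =i codom alpha'.
  by move=> i; exact: iffb (iff_sym (jumpU A i)) (iff_sym (jumpU A' i)).
have eq_b : codom beta =i codom beta'.
  by move=> i; exact: iffb (betaP A i) (betaP A' i).
have eq_g : codom gamma =i codom gamma'.
  by move=> i; exact: iffb (gammaP A i) (gammaP A' i).
have set_codom m m' (h : 'I_m -> 'I_n) (h' : 'I_m' -> 'I_n) :
    codom h =i codom h' -> [set h i | i : 'I_m] = [set h' i | i : 'I_m'].
  move=> eqh; apply/setP => i; apply/imsetP/imsetP => -[j _ ->].
    by have /codomP[j' ->] : h j \in codom h'; [rewrite -eqh codom_f | exists j'].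
  by have /codomP[j' ->] : h' j \in codom h; [rewrite eqh codom_f | exists j'].
split; try exact: set_codom.
apply: sigma_perm_eq => //;
  [exact: gamma_inj A | exact: delta_inj A | exact: gamma_neq_delta A
  |exact: gamma_inj A' | exact: delta_inj A' | exact: gamma_neq_delta A' |].
move=> s t st.
have eq_le (j : 'I_n) : (delta s <= j)%N = (delta' t <= j)%N.
  apply: iffb (iff_sym (jump_gamma A s j)) _; rewrite st.
  exact: iff_sym (jump_gamma A' t j).
by apply/val_inj/eqP; rewrite eqn_leq eq_le leqnn -eq_le leqnn.
Qed.
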